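(* Let $A\in\mathbb{R}^{m\times m}$ be symmetric positive definite with orthonormal eigenvectors $z_1,\dots,z_m$ and corresponding eigenvalues $0<\lambda_1\leqslant\lambda_2\leqslant\dots\leqslant\lambda_m$, let $b\in\mathbb{R}^m$, and let $x$ be the exact solution of $Ax=b$. Let $s$ be an integer with $2\leqslant s\leqslant m$. Let $x_0\in\mathbb{R}^m$ be an initial guess vector, write $$x-x_0=\sum_{i=1}^m\gamma_i z_i,$$ and let $\bar{x}_0$ be the vector defined by $$x-\bar{x}_0=\sum_{i=s}^m\gamma_i z_i .$$ Let $x_j$, $j=1,2,\dots$, be the iterands of the conjugate gradient method applied to $Ax=b$ with initial guess $x_0$. Put $$C_s=\frac{\sqrt{\kappa_s}-1}{\sqrt{\kappa_s}+1},\qquad \kappa_s=\frac{\lambda_m}{\lambda_s}.$$ Let $J$ be a positive integer and suppose that there exists a constant $\delta>0$ such that $$\frac{\sum_{i=1}^{s-1}\lambda_i\gamma_i^2}{\sum_{i=s}^m\lambda_i\gamma_i^2}=\frac{\sum_{i=1}^{s-1}\lambda_i\gamma_i^2}{\|x-\bar{x}_0\|_A^2}\leqslant 4C_s^{2j}\,\delta\qquad\text{for } j=1,\dots,J .$$ Then $$\|x-x_j\|_A^2\leqslant 4(1+\delta)\,C_s^{2j}\,\|x-x_0\|_A^2\qquad\text{for } j=1,\dots,J .$$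
   Context: For a symmetric positive definite matrix $A$, $\|v\|_A=\sqrt{v^{\top}Av}$. Round-off errors are neglected, i.e. the conjugate gradient (CG) method is considered in exact arithmetic. The CG iterands $x_j$ started at $x_0$ are characterized by: $x_j$ is the unique minimizer of $\|x-y\|_A$ over $y\in x_0+\mathrm{span}\{r_0,Ar_0,\dots,A^{j-1}r_0\}$, where $r_0=b-Ax_0$. Equivalently, $$\|x-x_j\|_A=\min_{q}\|q(A)(x-x_0)\|_A,$$ where the minimum is over all real polynomials $q$ of degree at most $j$ with constant term $q(0)=1$. If the exact solution is reached at some step, all later iterands are taken equal to $x$. The quotient in the hypothesis is understood to have a nonzero denominator. *)

(* Defs.v *)
From HB Require Import structures.
From mathcomp Require Import all_boot all_order all_algebra.
From mathcomp Require Import reals.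

Set Implicit Arguments.
Unset Strict Implicit.
Unset Printing Implicit Defensive.

Import Order.TTheory GRing.Theory Num.Theory.

Local Open Scope ring_scope.

Definition spdmx (R : realType) (m : nat) (A : 'M[R]_m) : Prop :=
  A^T = A /\ forall v : 'cV[R]_m, v != 0 -> 0 < (v^T *m A *m v) 0 0.

Definition energy_norm (R : realType) (m : nat) (A : 'M[R]_m)
    (v : 'cV[R]_m) : R :=
  Num.sqrt ((v^T *m A *m v) 0 0).

Definition krylov (R : realType) (m : nat) (A : 'M[R]_m) (r : 'cV[R]_m)
    (j : nat) : {vspace 'cV[R]_m} :=
  <<[seq A ^+ k *m r | k <- iota 0 j]>>%VS.

(* [x] is meant to be the exact solution of [A *m x = b].  For [A] symmetric
   positive definite the minimizer is unique; and as soon as [x] lies in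
   [x0 + krylov A (b - A *m x0) j], it is the iterand for this [j] and for all
   larger ones, so that termination needs no separate clause. *)
Definition cg_iterand (R : realType) (m : nat) (A : 'M[R]_m)
    (b x x0 : 'cV[R]_m) (j : nat) (xj : 'cV[R]_m) : Prop :=
  let K := krylov A (b - A *m x0) j in
  xj - x0 \in K /\
  forall y : 'cV[R]_m, y - x0 \in K ->
    energy_norm A (x - xj) <= energy_norm A (x - y).

Definition cg_factor (R : realType) (kappa : R) : R :=
  (Num.sqrt kappa - 1) / (Num.sqrt kappa + 1).

(* Main.v *)
(** By optimality of the CG iterand it suffices to exhibit one polynomial [q]
    of degree at most [j] with [q 0 = 1].  The Chebyshev polynomial of the
    interval [[lam s, lam m]], normalized at [0], is at most [2 * Cs ^+ j] in
    absolute value on that interval; being monotone to its left, it also takes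
    values between [-1] and [1] on [[0, lam s]].  Hence the first [s - 1]
    modes contribute at most their initial energy, which the hypothesis
    bounds, and the other modes contract by [4 * Cs ^+ (2 * j)]. *)
Require Import Defs.
From HB Require Import structures.
From mathcomp Require Import all_boot all_order all_algebra.
From mathcomp Require Import reals.
From mathcomp Require Import ring lra.

Set Implicit Arguments.
Unset Strict Implicit.
Unset Printing Implicit Defensive.

Import Order.TTheory GRing.Theory Num.Theory.

Local Open Scope ring_scope.

(** * Chebyshev polynomials of the first kind *)

Fixpoint chebyshev (R : comNzRingType) (x : R) (n : nat) : R :=
  match n with
  | 0 => 1
  | 1 => x
  | (n'.+1 as n1).+1 => x *+ 2 * chebyshev x n1 - chebyshev x n'
  end.

Lemma chebyshevSS (R : comNzRingType) (x : R) n :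
  chebyshev x n.+2 = x *+ 2 * chebyshev x n.+1 - chebyshev x n.
Proof. by []. Qed.

(** The recursion makes sense over any commutative ring, so one definition gives both the polynomial
    [T_n(p)] and its values; evaluation is a ring morphism and commutes with it. *)
Lemma horner_chebyshev (R : comNzRingType) (p : {poly R}) (x : R) n :
  (chebyshev p n).[x] = chebyshev p.[x] n.
Proof.
suff: (chebyshev p n).[x] = chebyshev p.[x] n /\
      (chebyshev p n.+1).[x] = chebyshev p.[x] n.+1 by case.
elim: n => [|n [IH1 IH2]]; first by rewrite /= hornerC.
split=> //; rewrite !chebyshevSS hornerD hornerN hornerM hornerMn.
by rewrite IH1 IH2.
Qed.

Lemma size_chebyshev (R : idomainType) (p : {poly R}) n :
  (size p <= 2)%N -> (size (chebyshev p n) <= n.+1)%N.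
Proof.
move=> sp.
suff: (size (chebyshev p n) <= n.+1)%N /\
      (size (chebyshev p n.+1) <= n.+2)%N by case.
elim: n => [|n [IH1 IH2]]; first by rewrite /= size_poly1.
split=> //; rewrite chebyshevSS.
apply: (leq_trans (size_polyD _ _)); rewrite geq_max size_polyN.
rewrite (leq_trans IH1) ?andbT; last by do 2 apply: leqW.
apply: (leq_trans (size_polyMleq _ _)).
have sp2 : (size (p *+ 2) <= 2)%N.
  by rewrite mulr2n (leq_trans (size_polyD _ _)) // maxnn.
by have := leq_add sp2 IH2; case: (_ + _)%N => [|k]; rewrite ?addSn ?ltnS.
Qed.

Section ChebyshevBounds.
Variable R : realFieldType.
Implicit Types x y c : R.

(** This is Pell's equation [T_n^2 + (1 - x^2) U_(n-1)^2 = 1] multiplied by [1 - x^2], with the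
    second-kind polynomial eliminated through [T_(n+1) - x T_n = - (1 - x^2) U_(n-1)]. *)
Lemma chebyshev_pell x n :
  (chebyshev x n.+1 - x * chebyshev x n) ^+ 2
    + (1 - x ^+ 2) * chebyshev x n ^+ 2 = 1 - x ^+ 2.
Proof.
elim: n => [|n IH]; first by rewrite /=; ring.
rewrite -[RHS]IH chebyshevSS; ring.
Qed.

Lemma chebyshev_sqr_le1 x n : -1 <= x <= 1 -> chebyshev x n ^+ 2 <= 1.
Proof.
move=> /andP[x1 x2]; have := chebyshev_pell x n.
have: 0 <= 1 - x ^+ 2 by nra.
rewrite le_eqVlt => /predU1P[/esym x0|x_gt0 pell].
  (* At [x = 1] or [x = -1] one cannot divide by [1 - x ^+ 2], but the Pell identity then forces
     [T_(n+1) = x T_n]. *)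
  suff: chebyshev x n ^+ 2 = 1 by move=> ->.
  elim: n => [|n IH]; first by rewrite /= expr1n.
  have := chebyshev_pell x n.
  rewrite x0 mul0r addr0 => /eqP; rewrite sqrf_eq0 subr_eq0 => /eqP ->.
  by rewrite exprMn IH mulr1; apply/eqP; rewrite eq_sym -subr_eq0 x0.
rewrite -(ler_pM2l x_gt0) mulr1 -[leRHS]pell lerDr.
exact: sqr_ge0.
Qed.

(* Both the values and their increments are monotone, by
   [T_(n+2) - T_(n+1) = 2 (x - 1) T_(n+1) + (T_(n+1) - T_n)]. *)
Lemma chebyshev_le x y n : 1 <= x -> x <= y ->
  1 <= chebyshev x n <= chebyshev y n.
Proof.
move=> x1 xy.
suff: 1 <= chebyshev x n <= chebyshev y n /\
      0 <= chebyshev x n.+1 - chebyshev x n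
        <= chebyshev y n.+1 - chebyshev y n by case.
elim: n => [|n [/andP[a1 a2] /andP[b1 b2]]]; first by split => /=; lra.
split; first by lra.
rewrite !chebyshevSS.
move: (chebyshev x n) (chebyshev y n) (chebyshev x n.+1) (chebyshev y n.+1)
  a1 a2 b1 b2 => p q p' q' a1 a2 b1 b2.
have h : 0 <= (x - 1) * p' by apply: mulr_ge0; lra.
have h' : (x - 1) * p' <= (y - 1) * q' by apply: ler_pM; lra.
by lra.
Qed.

(* At [x = (c + c^-1) / 2] one has [T_n x = (c ^+ n + c ^- n) / 2]. *)
Lemma chebyshev_joukowski x c n : 2 * c * x = c ^+ 2 + 1 ->
  2 * c ^+ n * chebyshev x n = c ^+ (2 * n) + 1.
Proof.
move=> cx.
suff: 2 * c ^+ n * chebyshev x n = c ^+ (2 * n) + 1 /\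
      2 * c ^+ n.+1 * chebyshev x n.+1 = c ^+ (2 * n.+1) + 1 by case.
elim: n => [|n [IH1 IH2]]; first by rewrite /= !expr1 muln1 cx; split; ring.
split=> //; rewrite chebyshevSS.
(* The recurrence times [2 * c ^+ n.+2]; nothing is divided by [c]. *)
transitivity ((2 * c * x) * (2 * c ^+ n.+1 * chebyshev x n.+1)
              - c ^+ 2 * (2 * c ^+ n * chebyshev x n)).
  by rewrite !exprS; ring.
rewrite IH1 IH2 cx !mul2n !doubleS !exprS; ring.
Qed.

End ChebyshevBounds.

(** * The normalized Chebyshev filter and its contraction factor *)

Lemma cg_factor_joukowski (R : realType) (kappa : R) : 1 < kappa ->
  2 * cg_factor kappa * ((kappa + 1) / (kappa - 1)) = cg_factor kappa ^+ 2 + 1.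
Proof.
(* With [r] the root of [kappa], [C = (r - 1) / (r + 1)] satisfies
   [C + C^-1 = 2 (r^2 + 1) / (r^2 - 1)]. *)
move=> k1; rewrite /cg_factor.
have k0 : 0 <= kappa by lra.
have := sqr_sqrtr k0; have := sqrtr_ge0 kappa.
move: (Num.sqrt kappa) => r r0 rk; rewrite -rk in k1 *.
field.
by apply/andP; split; apply: lt0r_neq0; nra.
Qed.

Lemma chebyshev_filter (R : realType) (l u : R) (j : nat) :
  0 < l -> l <= u -> (0 < j)%N ->
  exists q : {poly R},
    [/\ (size q <= j.+1)%N, q.[0] = 1,
        forall t, 0 <= t <= l -> q.[t] ^+ 2 <= 1
      & forall t, l <= t <= u ->
          q.[t] ^+ 2 <= 4 * cg_factor (u / l) ^+ (2 * j)].
Proof.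
move=> l0; rewrite le_eqVlt => /predU1P[<- j0|lu _].
  (* The affine map onto [-1, 1] degenerates; a power of [1 - t / l] vanishes
     at [l], matching [cg_factor 1 = 0]. *)
  pose p : {poly R} := 1 - l^-1 *: 'X.
  have pE t : p.[t] = 1 - l^-1 * t by rewrite /p !hornerE.
  exists (p ^+ j); split.
  - have: (size p <= 2)%N.
      rewrite (leq_trans (size_polyD _ _)) // geq_max size_poly1 size_polyN.
      by rewrite (leq_trans (size_scale_leq _ _)) ?size_polyX.
    move=> sp.
    apply: leq_trans (size_poly_exp_leq _ _) _.
    by rewrite ltnS -[leqRHS]mul1n leq_mul2r -subn1 leq_subLR sp orbT.
  - by rewrite horner_exp pE mulr0 subr0 expr1n.
  - move=> t /andP[t0 tl].
    rewrite horner_exp pE -exprM mulnC exprM exprn_ile1 ?sqr_ge0 //.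
    have h1 : 0 <= l^-1 * t by rewrite mulr_ge0 // invr_ge0 ltW.
    have h2 : l^-1 * t <= 1 by rewrite mulrC ler_pdivrMr // mul1r.
    by nra.
  - move=> t /le_anti tl; rewrite -tl horner_exp pE.
    rewrite mulVf ?gt_eqF // subrr expr0n gtn_eqF // expr0n /=.
    by rewrite mulr_ge0 // exprM exprn_ge0 // sqr_ge0.
set C := cg_factor _.
have ul0 : 0 < u - l by lra.
(* The affine map sending [l] to [1], [u] to [-1], and [0] to [(kappa + 1) / (kappa - 1)] for
   [kappa = u / l]. *)
pose p : {poly R} := ((u + l) / (u - l))%:P - (2 / (u - l)) *: 'X.
have pE t : p.[t] = (u + l - 2 * t) / (u - l).
  by rewrite /p !hornerE; field; rewrite gt_eqF.
have sp : (size p <= 2)%N.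
  rewrite (leq_trans (size_polyD _ _)) // geq_max size_polyN.
  by rewrite (leq_trans (size_scale_leq _ _)) ?size_polyX //
    (leq_trans (size_polyC_leq1 _)).
pose N := chebyshev p.[0] j.
have p0 : 1 <= p.[0] by rewrite pE ler_pdivlMr //; lra.
have N1 : 1 <= N by case/andP: (chebyshev_le j p0 (lexx p.[0])).
have N0 : 0 < N by lra.
exists (N^-1 *: chebyshev p j); split.
- by rewrite (leq_trans (size_scale_leq _ _)) // size_chebyshev.
- by rewrite hornerZ horner_chebyshev mulVf // gt_eqF.
- move=> t /andP[t0 tl]; rewrite hornerZ horner_chebyshev.
  (* Left of [l], [p.[t]] lies between [1] and [p.[0]], where [T_j] is monotone, so the quotient by
     [N] lies in [[0, 1]]. *)
  have pt1 : 1 <= p.[t] by rewrite pE ler_pdivlMr //; lra.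
  have ptp0 : p.[t] <= p.[0].
    by rewrite !pE ler_pM2r ?invr_gt0 //; lra.
  have /andP[h1 h2] := chebyshev_le j pt1 ptp0.
  apply: exprn_ile1; last by rewrite mulrC ler_pdivrMr // mul1r.
  by rewrite mulr_ge0 ?invr_ge0 ?(ltW N0) //; lra.
- move=> t /andP[tl tu]; rewrite hornerZ horner_chebyshev exprMn.
  have pt1 : -1 <= p.[t] <= 1.
    by rewrite pE ler_pdivlMr // ler_pdivrMr //; lra.
  have /(ler_wpM2l (sqr_ge0 N^-1)) := chebyshev_sqr_le1 j pt1.
  rewrite mulr1 => /le_trans; apply.
  have k1 : 1 < u / l by rewrite ltr_pdivlMr // mul1r.
  have Cp : 2 * C * p.[0] = C ^+ 2 + 1.
    rewrite -(cg_factor_joukowski k1) pE; congr (_ * _).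
    by field; apply/andP; split; rewrite gt_eqF //; lra.
  have := chebyshev_joukowski j Cp; rewrite -/N => CN.
  (* Equivalent to [N^-1 <= 2 * C ^+ j], whose square is the required bound. *)
  have h : 1 <= 2 * C ^+ j * N by rewrite CN lerDr exprM exprn_ge0 ?sqr_ge0.
  rewrite exprVn -[leLHS]mul1r ler_pdivrMr ?exprn_gt0 //.
  have -> : 4 * C ^+ (2 * j) * N ^+ 2 = (2 * C ^+ j * N) ^+ 2.
    by rewrite mulnC exprM; ring.
  by rewrite exprn_ege1.
Qed.

(** * Energy norms and Krylov spaces in the eigenbasis *)

Section SpectralExpansion.
Variables (R : realType) (m : nat) (A : 'M[R]_m).
Variables (z : nat -> 'cV[R]_m) (lam : nat -> R).
Hypothesis z_orthonormal : forall i k : nat, (1 <= i <= m)%N ->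
  (1 <= k <= m)%N -> ((z i)^T *m z k) 0 0 = (i == k)%:R.
Hypothesis z_eigen : forall i : nat, (1 <= i <= m)%N ->
  A *m z i = lam i *: z i.

Lemma mulmx_eigen_sum a (c : nat -> R) : (0 < a)%N ->
  A *m (\sum_(a <= i < m.+1) c i *: z i)
    = \sum_(a <= i < m.+1) (lam i * c i) *: z i.
Proof.
move=> a0; rewrite mulmx_sumr; apply: eq_big_nat => i /andP[ai im].
by rewrite -scalemxAr z_eigen ?(leq_trans a0 ai) // scalerA mulrC.
Qed.

Lemma expmx_eigen_sum (c : nat -> R) k :
  A ^+ k *m (\sum_(1 <= i < m.+1) c i *: z i)
    = \sum_(1 <= i < m.+1) (lam i ^+ k * c i) *: z i.
Proof.
elim: k => [|k IH].
  by rewrite expr0 mul1mx; apply: eq_bigr => i _; rewrite expr0 mul1r.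
rewrite exprS -mulmxA IH mulmx_eigen_sum //.
by apply: eq_bigr => i _; rewrite mulrA -exprS.
Qed.

Lemma energy_form_eigen_sum a (c : nat -> R) : (0 < a)%N ->
  let v := \sum_(a <= i < m.+1) c i *: z i in
  (v^T *m A *m v) 0 0 = \sum_(a <= i < m.+1) lam i * c i ^+ 2.
Proof.
move=> a0 /=; rewrite -mulmxA mulmx_eigen_sum // [in LHS](linear_sum trmx).
rewrite mulmx_suml summxE.
apply: eq_big_nat => i /andP[ai im].
rewrite mulmx_sumr summxE (bigD1_seq i) ?iota_uniq ?mem_index_iota ?ai //=.
have i1m : (1 <= i <= m)%N by rewrite (leq_trans a0 ai).
rewrite big_nat_cond big1 => [|k /andP[/andP[ak km] ki]].
  rewrite addr0 [(_ *: _)^T]linearZ -scalemxAl -scalemxAr mxE mxE.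
  rewrite z_orthonormal // eqxx.
  by rewrite mulr1; ring.
rewrite [(_ *: _)^T]linearZ -scalemxAl -scalemxAr mxE mxE z_orthonormal //.
  by rewrite eq_sym (negPf ki) !mulr0.
by rewrite (leq_trans a0 ak).
Qed.

Lemma energy_norm_eigen_sum a (c : nat -> R) : (0 < a)%N ->
  (forall i : nat, (1 <= i <= m)%N -> 0 <= lam i) ->
  energy_norm A (\sum_(a <= i < m.+1) c i *: z i) ^+ 2
    = \sum_(a <= i < m.+1) lam i * c i ^+ 2.
Proof.
move=> a0 lam_ge0; rewrite /energy_norm energy_form_eigen_sum // sqr_sqrtr //.
rewrite big_nat_cond sumr_ge0 // => i /andP[/andP[ai im] _].
by rewrite mulr_ge0 ?sqr_ge0 // lam_ge0 // (leq_trans a0 ai).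
Qed.

(** Since [q.[0] = 1], [1 - q] is divisible by ['X] with a quotient of degree below [j]. Applied to
    the initial error, the factor ['X] yields the residual [r], and the quotient yields a
    combination of the [A ^+ k *m r] with [k < j]. *)
Lemma filtered_error_in_krylov (q : {poly R}) (c : nat -> R) j r :
  (size q <= j.+1)%N -> q.[0] = 1 ->
  r = A *m (\sum_(1 <= i < m.+1) c i *: z i) ->
  \sum_(1 <= i < m.+1) c i *: z i
    - \sum_(1 <= i < m.+1) (q.[lam i] * c i) *: z i \in krylov A r j.
Proof.
move=> sq q0 ->.
have -> : \sum_(1 <= i < m.+1) c i *: z i
    - \sum_(1 <= i < m.+1) (q.[lam i] * c i) *: z i
  = \sum_(k < j) - q`_k.+1 *:
      (A ^+ k *m (A *m (\sum_(1 <= i < m.+1) c i *: z i))).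
  rewrite mulmx_eigen_sum // -sumrB.
  under [RHS]eq_bigr => k _ do rewrite expmx_eigen_sum scaler_sumr.
  rewrite exchange_big /=; apply: eq_bigr => i _.
  under eq_bigr => k _ do rewrite scalerA.
  rewrite -scaler_suml -scalerBl; congr (_ *: _).
  rewrite (horner_coef_wide _ sq) big_ord_recl -horner_coef0 q0 expr0 mulr1.
  rewrite mulrDl mul1r opprD addNKr mulr_suml -sumrN.
  by apply: eq_bigr => k _; rewrite lift0 exprS; ring.
apply: memv_suml => k _; apply/memvZ/memv_span/mapP.
by exists (k : nat); rewrite // mem_iota add0n ltn_ord.
Qed.

End SpectralExpansion.

(* The families z, lam and gam are indexed from 1 to m; their values at other
   indices play no role. *)
Theorem theorem3p2 (R : realType) (m : nat) (A : 'M[R]_m)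
    (z : nat -> 'cV[R]_m) (lam gam : nat -> R)
    (b x x0 xbar0 : 'cV[R]_m) (xs : nat -> 'cV[R]_m) (s : nat)
    (A_spd : spdmx A)
    (z_orthonormal : forall i k : nat, (1 <= i <= m)%N -> (1 <= k <= m)%N ->
       ((z i)^T *m z k) 0 0 = (i == k)%:R)
    (z_eigen : forall i : nat, (1 <= i <= m)%N -> A *m z i = lam i *: z i)
    (lam_gt0 : 0 < lam 1%N)
    (lam_sorted : forall i k : nat, (1 <= i)%N -> (i <= k)%N -> (k <= m)%N ->
       lam i <= lam k)
    (x_sol : A *m x = b)
    (s_range : (2 <= s <= m)%N)
    (x0E : x - x0 = \sum_(1 <= i < m.+1) gam i *: z i)
    (xbar0E : x - xbar0 = \sum_(s <= i < m.+1) gam i *: z i)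
    (xs_cg : forall j : nat, (1 <= j)%N -> cg_iterand A b x x0 j (xs j))
    (denom_neq0 : \sum_(s <= i < m.+1) lam i * gam i ^+ 2 != 0) :
  let Cs := cg_factor (lam m / lam s) in
  let quot := (\sum_(1 <= i < s) lam i * gam i ^+ 2)
              / (\sum_(s <= i < m.+1) lam i * gam i ^+ 2) in
  quot = (\sum_(1 <= i < s) lam i * gam i ^+ 2)
         / energy_norm A (x - xbar0) ^+ 2
  /\
  forall (J : nat) (delta : R), (0 < J)%N -> 0 < delta ->
    (forall j : nat, (1 <= j <= J)%N ->
       quot <= 4 * Cs ^+ (2 * j) * delta) ->
    forall j : nat, (1 <= j <= J)%N ->
      energy_norm A (x - xs j) ^+ 2
        <= 4 * (1 + delta) * Cs ^+ (2 * j) * energy_norm A (x - x0) ^+ 2.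
move=> Cs quot.
have [s2 sm] := andP s_range.
have s1 : (0 < s)%N by apply: leq_trans s2.
have lam_ge i : (1 <= i <= m)%N -> 0 < lam i.
  by move=> /andP[i1 im]; rewrite (lt_le_trans lam_gt0) ?lam_sorted.
have lam_ge0 i : (1 <= i <= m)%N -> 0 <= lam i by move=> /lam_ge/ltW.
have normE := energy_norm_eigen_sum z_orthonormal z_eigen.
split; first by rewrite xbar0E normE.
move=> J delta J0 delta0 quot_le j jJ; have [j1 _] := andP jJ.
have [q [sq q0 q_low q_high]] :=
  chebyshev_filter (lam_ge s ltac:(by rewrite s1 sm))
    (lam_sorted _ _ s1 sm (leqnn m)) j1.
have := quot_le j jJ; rewrite /quot.
set S2 := \sum_(s <= i < m.+1) _ in denom_neq0 *.
set S1 := \sum_(1 <= i < s) _.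
have S1_ge0 : 0 <= S1.
  rewrite /S1 big_nat_cond sumr_ge0 // => i /andP[/andP[i1 im] _].
  by rewrite mulr_ge0 ?sqr_ge0 // lam_ge0 // i1 (leq_trans (ltnW im)).
have S2_gt0 : 0 < S2.
  rewrite lt_neqAle eq_sym denom_neq0 /S2 big_nat_cond sumr_ge0 //.
  move=> i /andP[/andP[i1 im] _].
  by rewrite mulr_ge0 ?sqr_ge0 // lam_ge0 // (leq_trans s1 i1).
rewrite ler_pdivrMr // => S1_le.
have [_ xs_min] := xs_cg j j1.
(* [e] is [q(A)] applied to the initial error; [x - e] competes with [xs j] in the minimization. *)
pose e := \sum_(1 <= i < m.+1) (q.[lam i] * gam i) *: z i.
have y_in : (x - e) - x0 \in krylov A (b - A *m x0) j.
  rewrite addrAC x0E; apply: filtered_error_in_krylov => //.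
  by rewrite -x0E mulmxBr x_sol.
have := xs_min _ y_in; rewrite opprB addrCA subrr addr0 => opt.
have {}opt := ler_pM (sqrtr_ge0 _) (sqrtr_ge0 _) opt opt.
rewrite -!expr2 in opt; apply: le_trans opt _.
rewrite /e x0E !normE // (big_cat_nat (n := s)) //= ?(leq_trans sm) //.
rewrite [in leRHS](big_cat_nat (n := s)) //= ?(leq_trans sm) // -/S1 -/S2.
set D := 4 * Cs ^+ (2 * j) in q_high S1_le *.
have D0 : 0 <= D by rewrite /D mulr_ge0 // exprM exprn_ge0 // sqr_ge0.
(* The low modes are merely not amplified; smallness comes from [S1_le]. *)
have low : \sum_(1 <= i < s) lam i * (q.[lam i] * gam i) ^+ 2 <= S1.
  apply: ler_sum_nat => i /andP[i1 im].
  have im' : (1 <= i <= m)%N by rewrite i1 (leq_trans (ltnW im)).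
  rewrite ler_wpM2l ?lam_ge0 // exprMn ler_piMl ?sqr_ge0 // q_low //.
  by rewrite lam_ge0 // lam_sorted // ltnW.
have high : \sum_(s <= i < m.+1) lam i * (q.[lam i] * gam i) ^+ 2 <= D * S2.
  rewrite /S2 mulr_sumr; apply: ler_sum_nat => i /andP[i1 im].
  have i0 : (0 < i)%N by rewrite (leq_trans s1).
  rewrite [leRHS]mulrCA ler_wpM2l ?lam_ge0 ?i0 // exprMn.
  by rewrite ler_wpM2r ?sqr_ge0 // q_high // !lam_sorted.
have -> : 4 * (1 + delta) * Cs ^+ (2 * j) = D * (1 + delta).
  by rewrite /D; ring.
(* The total is at most [S1 + D * S2], hence at most [D * (1 + delta) * S2] by [S1_le]; [h] allows
   enlarging [S2] to the full initial energy [S1 + S2]. *)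
have h : 0 <= D * (1 + delta) * S1.
  by rewrite (mulr_ge0 (mulr_ge0 D0 _)) //; lra.
rewrite mulrDr; apply: le_trans (lerD low high) _.
by lra.
Qed.
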